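(* Let $n\ge1$, $x=(x_1,\dots,x_n)$, and $[n]=\{1,\dots,n\}$. For $I\subset[n]$ let $|I|$ be its cardinality and $J=[n]-I$. Then \[ \sum_{k=0}^{\infty}u^k\sum_{\lambda:\,\lambda_1\le k}q^{n(\lambda)}P_{\lambda}(x;q) =\sum_{I\subset[n]}\frac{1}{1-uq^{\binom{|I|}{2}}\prod_{i\in I}x_i}\prod_{i\in I}\frac{1}{1-x_i^{-1}q^{1-|I|}}\prod_{j\in J}\frac{1}{1-x_jq^{|I|}}\prod_{i\in I,\,j\in J}\frac{x_i-qx_j}{x_i-x_j}, \] where the inner sum on the left is over partitions $\lambda$ with largest part at most $k$.
   Context: For a partition $\lambda$, $\ell(\lambda)$ is its number of nonzero parts and $n(\lambda)=\sum_{i\ge1}(i-1)\lambda_i$. For $\ell(\lambda)\le n$ the Hall–Littlewood polynomial is $P_\lambda(x;q)=\sum_{w\in S_n/S_n^\lambda} w\bigl(x^\lambda\prod_{i<j:\,\lambda_i>\lambda_j}\frac{x_i-qx_j}{x_i-x_j}\bigr)$, with $S_n^\lambda$ the subgroup of permutations fixing $\lambda=(\lambda_1,\dots,\lambda_n)$ and $w$ acting by permuting the variables; $P_\lambda(x;q)=0$ if $\ell(\lambda)>n$. *)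

(* Defs.v *)
From HB Require Import structures.
From mathcomp Require Import all_boot all_order all_algebra all_fingroup.
From mathcomp Require Import boolp classical_sets cardinality fsbigop.
From mathcomp.multinomials Require Import mpoly.

Set Implicit Arguments.
Unset Strict Implicit.
Unset Printing Implicit Defensive.

Import Order.TTheory GRing.Theory Num.Theory.
Local Open Scope ring_scope.

(* Formal power series in one variable u: [Fps c] is \sum_(k >= 0) c_k u^k.   *)
Record fps (R : Type) := Fps { fcoef : nat -> R }.

Lemma fpsP (R : Type) (f g : fps R) : fcoef f =1 fcoef g -> f = g.
Proof. by case: f g => [a] [b] /= /funext->. Qed.

HB.instance Definition _ (R : Type) := gen_eqMixin (fps R).
HB.instance Definition _ (R : Type) := gen_choiceMixin (fps R).

Section FpsRing.
Variable R : comNzRingType.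
Implicit Types f g h : fps R.

Definition fps_zero : fps R := Fps (fun=> 0).
Definition fps_opp f := Fps (fun k => - fcoef f k).
Definition fps_add f g := Fps (fun k => fcoef f k + fcoef g k).
Definition fps_const (c : R) : fps R := Fps (fun k => if k == 0%N then c else 0).
Definition fps_var : fps R := Fps (fun k => (k == 1%N)%:R).
Definition fps_mul f g :=
  Fps (fun k => \sum_(i < k.+1) fcoef f i * fcoef g (k - i)).

Fact fps_addA : associative fps_add.
Proof. by move=> f g h; apply: fpsP => k /=; rewrite addrA. Qed.
Fact fps_addC : commutative fps_add.
Proof. by move=> f g; apply: fpsP => k /=; rewrite addrC. Qed.
Fact fps_add0 : left_id fps_zero fps_add.
Proof. by move=> f; apply: fpsP => k /=; rewrite add0r. Qed.
Fact fps_addN : left_inverse fps_zero fps_opp fps_add.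
Proof. by move=> f; apply: fpsP => k /=; rewrite addNr. Qed.

HB.instance Definition _ :=
  GRing.isZmodule.Build (fps R) fps_addA fps_addC fps_add0 fps_addN.

Let trunc N f : {poly R} := \poly_(i < N) fcoef f i.

Let trunc_mul N f g k : (k < N)%N ->
  (trunc N f * trunc N g)`_k = fcoef (fps_mul f g) k.
Proof.
move=> kN; rewrite coefM; apply: eq_bigr => i _; rewrite !coef_poly.
rewrite (leq_ltn_trans _ kN) ?(leq_ltn_trans (leq_subr i k) kN) //.
by rewrite -ltnS.
Qed.

Fact fps_mulA : associative fps_mul.
Proof.
move=> f g h; apply: fpsP => k; set N := k.+1.
have tl a b c :
    (trunc N (fps_mul a b) * trunc N c)`_k = (trunc N a * trunc N b * trunc N c)`_k.
  rewrite !coefM; apply: eq_bigr => i _; congr (_ * _).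
  by rewrite coef_poly ltn_ord -(@trunc_mul N).
by rewrite -!(@trunc_mul N) // mulrC !tl mulrC mulrA.
Qed.

Fact fps_mulC : commutative fps_mul.
Proof.
move=> f g; apply: fpsP => k.
by rewrite -!(@trunc_mul k.+1) // mulrC.
Qed.

Fact fps_mul1 : left_id (fps_const 1) fps_mul.
Proof.
move=> f; apply: fpsP => k /=.
rewrite big_ord_recl /= mul1r subn0 big1 ?addr0 // => i _.
by rewrite mul0r.
Qed.

Fact fps_mulDl : left_distributive fps_mul fps_add.
Proof.
move=> f g h; apply: fpsP => k /=.
by rewrite -big_split; apply: eq_bigr => i _; rewrite mulrDl.
Qed.

Fact fps_1neq0 : fps_const 1 != 0.
Proof.
apply/eqP => /(congr1 (fun f => fcoef f 0)) /= /eqP.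
by rewrite oner_eq0.
Qed.

HB.instance Definition _ := GRing.Zmodule_isComNzRing.Build (fps R)
  fps_mulA fps_mulC fps_mul1 fps_mulDl fps_1neq0.

Definition fps_unit : {pred fps R} := [pred f | `[< exists g, g * f = 1 >]].
Definition fps_inv f : fps R :=
  if pselect (exists g, g * f = 1) is left e then projT1 (cid e) else f.

Fact fps_mulV : {in fps_unit, left_inverse 1 fps_inv *%R}.
Proof.
move=> f /asboolP ex; rewrite /fps_inv; case: pselect => // e.
exact: projT2 (cid e).
Qed.
Fact fps_unitP f g : g * f = 1 -> fps_unit f.
Proof. by move=> gf; apply/asboolP; exists g. Qed.
Fact fps_inv_out : {in [predC fps_unit], fps_inv =1 id}.
Proof. by move=> f /asboolPn nex; rewrite /fps_inv; case: pselect. Qed.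

HB.instance Definition _ := GRing.ComNzRing_hasMulInverse.Build (fps R)
  fps_mulV fps_unitP fps_inv_out.

End FpsRing.

Notation "c %:S" := (fps_const c)
  (at level 2, left associativity, format "c %:S") : ring_scope.
Notation "''u'" := (@fps_var _) : ring_scope.

Section FpsTheory.
Variable R : comNzRingType.
Implicit Types (f : fps R) (c : R).

Lemma fcoefD f g k : fcoef (f + g) k = fcoef f k + fcoef g k.
Proof. by []. Qed.

Lemma fcoef_sum I (r : seq I) (P : pred I) (F : I -> fps R) k :
  fcoef (\sum_(i <- r | P i) F i) k = \sum_(i <- r | P i) fcoef (F i) k.
Proof. exact: (big_morph (fun f => fcoef f k)). Qed.

Lemma fcoef_mulC f c k : fcoef (f * c%:S) k = fcoef f k * c.
Proof.
rewrite mulrC /= big_ord_recl /= subn0 mulrC big1 ?addr0 // => i _.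
by rewrite mul0r.
Qed.

Lemma fcoef_uM f k : fcoef ('u * f) k = if k is k'.+1 then fcoef f k' else 0.
Proof.
case: k => [|k] /=; first by rewrite big_ord1 mul0r.
rewrite !big_ord_recl /= mul0r add0r mul1r subSS subn0 big1 ?addr0 // => i _.
by rewrite mul0r.
Qed.

Lemma fcoef_un n k : fcoef ('u ^+ n) k = (k == n)%:R :> R.
Proof.
by elim: n k => [|n IHn] [|k] //; rewrite exprS fcoef_uM ?IHn.
Qed.

(* [Fps c] is the u-adic limit of the partial sums of \sum_k u^k c_k.         *)
Lemma fcoef_partial_sum (c : nat -> R) N k : (k < N)%N ->
  fcoef (\sum_(i < N) 'u ^+ i * (c i)%:S) k = fcoef (Fps c) k.
Proof.
move=> kN; rewrite fcoef_sum (bigD1 (Ordinal kN)) // fcoef_mulC fcoef_un.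
rewrite eqxx mul1r big1 => [|i]; first exact: addr0.
rewrite -val_eqE => /negPf ik; change ((i == k :> nat) = false) in ik.
by rewrite fcoef_mulC fcoef_un eq_sym ik mul0r.
Qed.

Lemma fps_geom c : (1 - 'u * c%:S)^-1 = Fps (fun k => c ^+ k).
Proof.
have H : (1 - 'u * c%:S) * Fps (fun k => c ^+ k) = 1.
  apply: fpsP => k; rewrite mulrBl mul1r -mulrA [c%:S * _]mulrC.
  rewrite fcoefD -[X in _ + X = _]/(- fcoef _ k) fcoef_uM.
  case: k => [|k]; first by rewrite /= expr0 subr0.
  by rewrite fcoef_mulC /= -exprSr subrr.
apply: (@mulrI _ (1 - 'u * c%:S)); first by apply/unitrPr; eexists; exact: H.
by rewrite H divrr //; apply/unitrPr; eexists; exact: H.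
Qed.

End FpsTheory.

(* A partition is listed as the sequence of its nonzero parts, so that        *)
(* l(lambda) is [size l] and lambda_(i+1) is [nth 0 l i].                     *)
Definition is_partition (l : seq nat) : bool := sorted geq l && (0%N \notin l).

Definition partition_n (l : seq nat) : nat :=
  (\sum_(i < size l) i * nth 0 l i)%N.

Section HallLittlewood.
Variables (F : fieldType) (n : nat) (q : F) (x : 'I_n -> F).
Implicit Type l : seq nat.

Definition part_stab l : {set 'S_n} :=
  [set w : 'S_n | [forall i : 'I_n, nth 0%N l (w i) == nth 0%N l i]].

(* w acts on rational functions by x_i |-> x_(w i); this is w applied to      *)
(* x^lambda \prod_(i < j, lambda_i > lambda_j) (x_i - q x_j) / (x_i - x_j).   *)
Definition hall_littlewood_term l (w : 'S_n) : F :=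
  (\prod_(i < n) x (w i) ^+ nth 0%N l i) *
  \prod_(i < n) \prod_(j < n | (i < j)%N && (nth 0%N l j < nth 0%N l i)%N)
     ((x (w i) - q * x (w j)) / (x (w i) - x (w j))).

(* Since [(v * w) i = w (v i)] in 'S_n, the left cosets of the stabilizer for *)
(* composition of functions are its right cosets for [*].                     *)
Definition hall_littlewood l : F :=
  if (size l <= n)%N then
    \sum_(C in rcosets (part_stab l) [set: 'S_n]) hall_littlewood_term l (repr C)
  else 0.

End HallLittlewood.

Lemma part_stab_group_set n l : group_set (part_stab n l).
Proof.
apply/group_setP; split=> [|v w]; first by rewrite inE; apply/forallP => i; rewrite perm1.
rewrite !inE => /forallP vl /forallP wl; apply/forallP => i.
by rewrite permM (eqP (wl _)) vl.
Qed.
Canonical part_stab_group n l := Group (part_stab_group_set n l).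

Lemma part_gt_index l i j : is_partition l ->
  (nth 0 l j < nth 0 l i)%N -> (i < j)%N.
Proof.
case/andP=> sl _ lij; rewrite ltnNge; apply/negP => ji.
have [il|il] := ltnP i (size l); last by rewrite (nth_default _ il) in lij.
move: lij; rewrite ltnNge => /negP; apply.
apply: (sorted_leq_nth (leT := geq)) => //; rewrite ?inE //.
- by move=> a b c /= ba ac; apply: leq_trans ac ba.
- exact: leqnn.
- exact: leq_ltn_trans il.
Qed.

Lemma hall_littlewood_term_coset (F : fieldType) n (q : F) (x : 'I_n -> F) l
    (v w : 'S_n) : is_partition l -> v \in part_stab n l ->
  hall_littlewood_term q x l (v * w)%g = hall_littlewood_term q x l w.
Proof.
move=> pl; rewrite inE => /forallP vl; rewrite /hall_littlewood_term.
have vE i : nth 0%N l (v i) = nth 0%N l i by apply/eqP.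
congr (_ * _).
  rewrite [RHS](reindex_inj (@perm_inj _ v)); apply: eq_bigr => i _.
  by rewrite permM vE.
have ltE i j : (i < j)%N && (nth 0 l j < nth 0 l i)%N =
    (nth 0 l j < nth 0 l i)%N.
  by apply: andb_idl; exact: part_gt_index.
rewrite [RHS](reindex_inj (@perm_inj _ v)); apply: eq_bigr => i _.
rewrite [RHS](reindex_inj (@perm_inj _ v)); apply: eq_big => [j|j _].
  by rewrite !ltE !vE.
by rewrite !permM.
Qed.

(* P_lambda = 0 when [size l > n], so a sum over the partitions with largest  *)
(* part at most k has finite support, as [\sum_(_ \in _)] requires.           *)
Lemma finite_bounded_partitions n k :
  finite_set [set l : seq nat |
    [&& is_partition l, (head 0 l <= k)%N & (size l <= n)%N]]%classic.
Proof.
pose f (t : n.-tuple 'I_k.+1) := [seq a <- map val t | a != 0%N].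
apply: (@sub_finite_set _ _ (f @` setT)%classic); last exact: finite_image.
move=> l /= /and3P[/andP[sl l0] hl szl].
have sz : size (map (@inord k) l ++ nseq (n - size l) ord0) == n.
  by rewrite size_cat size_map size_nseq subnKC.
exists (Tuple sz) => //; rewrite /f /= map_cat map_nseq -map_comp filter_cat.
have -> : [seq a <- nseq (n - size l) (val (@ord0 k)) | a != 0%N] = [::].
  by elim: (n - size l)%N.
rewrite cats0; have -> : [seq (val \o @inord k) i | i <- l] = l.
  rewrite -[RHS]map_id; apply/eq_in_map => a al /=; rewrite inordK // ltnS.
  apply: leq_trans hl; case: l sl al {l0 szl sz} => // b l /= bl.
  rewrite inE => /predU1P[->//|al].
  have tr : transitive geq by move=> c d e /= cd de; apply: leq_trans de cd.
  by have /allP := order_path_min tr bl; apply.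
apply/all_filterP/allP => a al; apply: contraNneq l0 => <-; exact: al.
Qed.

(* The coefficient field Q(q, x_1, ..., x_n).                                 *)
Section RationalFunctions.
Variable n : nat.

Definition ratfun : fieldType := {fraction {mpoly {poly rat}[n]}}.
Definition rf_q : ratfun := tofrac (('X : {poly rat})%:MP_[n]).
Definition rf_x (i : 'I_n) : ratfun := tofrac ('X_i : {mpoly {poly rat}[n]}).
End RationalFunctions.

(* Main.v *)
(* Listing a term of P_lambda by the function f : [n] -> [0, k] of its exponents,
   f is the chain of its superlevel sets, n(lambda) is the sum of binomials
   C(#|{f > r}|, 2), and the product of (x_i - q x_j)/(x_i - x_j) over
   f(i) > f(j) splits along the chain. Peeling off the largest set B = {f > 0}
   of the chain, the coefficients S_k(A) of the left-hand side, for the variables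
   in A, satisfy S_0 = 1 and
     S_(k+1)(A) = \sum_(B in A) q^C(#|B|,2) x_B W(B, A - B) S_k(B).
   The coefficients R_k of the right-hand side satisfy the same recursion by
     \sum_(D in E) q^C(#|D|,2) y_D W(D, E - D) \prod_(E - D) (1 - y_j) = 1,
   applied to y = q^#|I| x. The same identity in y = q^(1-#|L|) x^-1 gives a second
   expression of R_1, in terms of R_0 with rescaled variables; comparing the two
   yields R_0 = 1. *)
Require Import Defs.
From mathcomp Require Import all_boot all_order all_algebra all_fingroup.
From mathcomp Require Import boolp classical_sets cardinality fsbigop.
From mathcomp.multinomials Require Import mpoly.
(* Last, so that set lemma names refer to finite sets. *)
From mathcomp Require Import fintype finset ring.

Set Implicit Arguments.
Unset Strict Implicit.
Unset Printing Implicit Defensive.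

Import Order.TTheory GRing.Theory Num.Theory.
Local Open Scope ring_scope.

(** * Reindexing sums over subsets and flags of subsets *)

Section SubsetSums.
Variables (T : finType) (V : nmodType).
Implicit Types (A B D E I L : {set T}).

Lemma sum_subsetU1 E e (G : {set T} -> V) : e \notin E ->
  \sum_(D : {set T} | D \subset e |: E) G D =
  \sum_(D : {set T} | D \subset E) (G D + G (e |: D)).
Proof.
move=> eE; rewrite (bigID (fun D : {set T} => e \in D)) /= addrC big_split /=.
congr (_ + _).
  by apply: eq_bigl => D; rewrite -[in RHS](setU1K eE) subsetD1.
rewrite (reindex_onto (fun D => e |: D) (fun D => D :\ e)) /=; last first.
  by move=> D /andP[_ eD]; rewrite setD1K.
apply: eq_bigl => D; rewrite setU11 andbT.
apply/andP/idP => [[sub /eqP <-]|DE].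
  by rewrite -(setU1K eE) setSD.
by rewrite setUS // setU1K ?eqxx //; apply: contra eE; exact: (subsetP DE).
Qed.

(** A flag I in B in A amounts to I in A together with D = B - I in A - I. *)
Lemma sum_subset_flag A (G : {set T} -> {set T} -> V) :
  \sum_(B : {set T} | B \subset A) \sum_(I : {set T} | I \subset B) G B I =
  \sum_(I : {set T} | I \subset A) \sum_(D : {set T} | D \subset A :\: I)
    G (I :|: D) I.
Proof.
rewrite (exchange_big_dep (fun I : {set T} => I \subset A)) /=; last first.
  by move=> B I BA IB; apply: subset_trans BA.
apply: eq_bigr => I IA.
rewrite (reindex_onto (fun D => I :|: D) (fun B => B :\: I)) /=; last first.
  move=> B /andP[_ IB].
  by rewrite -{1}(setIidPr IB) setID.
apply: eq_bigl => D; rewrite subUset IA subsetUl andbT subsetD /=; congr (_ && _).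
rewrite setDUl setDv set0U; apply/eqP/idP => [<-|]; last by move/setDidPl.
by rewrite disjoints_subset subsetDr.
Qed.

Lemma sum_subset_compl L (G : {set T} -> V) :
  \sum_(D : {set T} | D \subset L) G D =
  \sum_(D : {set T} | D \subset L) G (L :\: D).
Proof.
rewrite (reindex_onto (fun D => L :\: D) (fun D => L :\: D)) /=; last first.
  by move=> D DL; rewrite setDDr setDv set0U (setIidPr DL).
apply: eq_bigl => D; rewrite subsetDl /= setDDr setDv set0U.
by apply/eqP/idP => [<-|/setIidPr//]; rewrite subsetIl.
Qed.

End SubsetSums.

Lemma prod_subset_if (R : comPzSemiRingType) (T : finType) (D E : {set T})
    (f g : T -> R) : D \subset E ->
  \prod_(i in E) (if i \in D then f i else g i) =
  (\prod_(i in D) f i) * \prod_(i in E :\: D) g i.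
Proof.
move=> DE; rewrite (big_setID D) /= (setIidPr DE); congr (_ * _).
  by apply: eq_bigr => i ->.
by apply: eq_bigr => i /setDP[_ /negPf->].
Qed.

Lemma prod_disjointU (R : comPzSemiRingType) (T : finType) (A B : {set T})
    (f : T -> R) : [disjoint A & B] ->
  \prod_(i in A :|: B) f i = (\prod_(i in A) f i) * \prod_(i in B) f i.
Proof. by move=> AB; rewrite -bigU //; apply: eq_bigl => i; rewrite !inE. Qed.

(** * Products of (x_i - q x_j)/(x_i - x_j) between two sets of variables *)

Section Interaction.
Variables (T : finType) (F : fieldType) (q : F).
Implicit Types (x y : T -> F) (A B D E I J L : {set T}).

Definition hl_cross x A B :=
  \prod_(i in A) \prod_(j in B) ((x i - q * x j) / (x i - x j)).

Lemma hl_cross0l x B : hl_cross x set0 B = 1.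
Proof. exact: big_set0. Qed.

Lemma hl_cross0r x A : hl_cross x A set0 = 1.
Proof. by apply: big1 => i _; rewrite big_set0. Qed.

Lemma hl_crossUl x A B J : [disjoint A & B] ->
  hl_cross x (A :|: B) J = hl_cross x A J * hl_cross x B J.
Proof. by move=> AB; rewrite /hl_cross prod_disjointU. Qed.

Lemma hl_crossUr x A B J : [disjoint A & B] ->
  hl_cross x J (A :|: B) = hl_cross x J A * hl_cross x J B.
Proof.
move=> AB; rewrite /hl_cross -big_split; apply: eq_bigr => i _.
by rewrite prod_disjointU.
Qed.

Lemma hl_cross1l x e B :
  hl_cross x [set e] B = \prod_(j in B) ((x e - q * x j) / (x e - x j)).
Proof. exact: big_set1. Qed.

Lemma hl_cross1r x e A :
  hl_cross x A [set e] = \prod_(i in A) ((x i - q * x e) / (x i - x e)).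
Proof. by apply: eq_bigr => i _; rewrite big_set1. Qed.

Lemma hl_cross_scale x c A B : c != 0 ->
  hl_cross (fun i => c * x i) A B = hl_cross x A B.
Proof.
move=> c0; apply: eq_bigr => i _; apply: eq_bigr => j _.
by rewrite mulrCA -!mulrBr invfM mulrACA divff ?mul1r.
Qed.

(** Inverting the variables turns the factor of (i, j) into (x_j - q x_i)/(x_j - x_i), the factor of
    (j, i). *)
Lemma hl_cross_inv x A B :
  {in A, forall i, x i != 0} -> {in B, forall i, x i != 0} ->
  hl_cross (fun i => (x i)^-1) A B = hl_cross x B A.
Proof.
move=> xA xB; rewrite /hl_cross exchange_big; apply: eq_bigr => j jB.
apply: eq_bigr => i iA; have xi := xA _ iA; have xj := xB _ jB.
have -> : (x i)^-1 - q * (x j)^-1 = (x j - q * x i) / (x i * x j).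
  by field; rewrite xi xj.
have -> : (x i)^-1 - (x j)^-1 = (x j - x i) / (x i * x j).
  by field; rewrite xi xj.
by rewrite invf_div mulrA divfK ?mulf_neq0.
Qed.

(** The summand of an identity: over all D in E these terms add up to 1 ([sum_hl_term]). *)
Definition hl_term x E D :=
  q ^+ 'C(#|D|, 2) * (\prod_(i in D) x i) * hl_cross x D (E :\: D) *
  \prod_(j in E :\: D) (1 - x j).

Lemma hl_term_out x E D e : e \notin E -> D \subset E ->
  hl_term x (e |: E) D =
  hl_term x E D * (\prod_(i in D) ((x i - q * x e) / (x i - x e))) * (1 - x e).
Proof.
move=> eE DE; have eD : e \notin D by apply: contra eE; exact: (subsetP DE).
have -> : hl_term x (e |: E) D = q ^+ 'C(#|D|, 2) * (\prod_(i in D) x i) *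
    hl_cross x D (e |: (E :\: D)) * \prod_(j in e |: (E :\: D)) (1 - x j).
  rewrite /hl_term; suff -> : (e |: E) :\: D = e |: (E :\: D) by [].
  by rewrite setDUl; congr (_ :|: _); apply/setDidPl; rewrite disjoints1.
have eED : e \notin E :\: D by rewrite inE negb_and eE orbT.
rewrite big_setU1 //= hl_crossUr ?disjoints1 // hl_cross1r /hl_term; ring.
Qed.

Lemma hl_term_in x E D e : e \notin E -> D \subset E ->
  hl_term x (e |: E) (e |: D) =
  hl_term x E D * q ^+ #|D| * x e *
    (\prod_(j in E :\: D) ((x e - q * x j) / (x e - x j))).
Proof.
move=> eE DE; have eD : e \notin D by apply: contra eE; exact: (subsetP DE).
rewrite /hl_term.
have -> : (e |: E) :\: (e |: D) = E :\: D.
  by rewrite -setDDl setU1K.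
rewrite big_setU1 //= cardsU1 eD add1n binS bin1 exprD.
rewrite hl_crossUl ?disjoints1 // hl_cross1l; ring.
Qed.

End Interaction.

(** * The subset identity, by polynomial interpolation *)

Lemma size_monic_diff (R : nzRingType) (p r : {poly R}) n :
  p \is monic -> r \is monic -> size p = n.+1 -> size r = n.+1 ->
  (size (p - r)%R <= n)%N.
Proof.
move=> pm rm sp sr; apply/leq_sizeP => j; rewrite leq_eqVlt => /predU1P[<-|nj].
  have := monicP pm; have := monicP rm.
  by rewrite /lead_coef sp sr coefB /= => -> ->; rewrite subrr.
by rewrite coefB !nth_default ?subrr // ?sp ?sr.
Qed.

Section Interpolation.
Variables (T : finType) (F : fieldType) (q : F).
Hypothesis q0 : q != 0.
Implicit Types (x y : T -> F) (A B D E I J L : {set T}).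

Let rootP x E D (a b : F) : {poly F} :=
  \prod_(i in E) ('X - (if i \in D then a * x i else b * x i)%:P).

Let rootP_monic x E D a b : rootP x E D a b \is monic.
Proof. exact: monic_prod_XsubC. Qed.

Let size_rootP x E D a b : size (rootP x E D a b) = #|E|.+1.
Proof. by rewrite /rootP -big_enum size_prod_XsubC -cardE. Qed.

Let hornerP x E D a b t : (rootP x E D a b).[t] =
  \prod_(i in E) (t - (if i \in D then a * x i else b * x i)).
Proof. by rewrite horner_prod; apply: eq_bigr => i _; rewrite !hornerE. Qed.

(** With t the value of a new variable e, this is the sum of the terms of D and [e |: D] for
    [e |: E], without their common factor [hl_term q x E D] and multiplied by the product of all t -
    x_i. The form chosen, with a difference of monic polynomials, makes the degree bound visible. *)
Let bracket x E D : {poly F} :=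
  q ^+ #|D| *: (rootP x E D q^-1 1 +
    'X * (rootP x E D 1 q - rootP x E D q^-1 1)).

Let bracketE x E D t : D \subset E -> (bracket x E D).[t] =
   (1 - t) * ((\prod_(i in D) (q * t - x i)) * \prod_(i in E :\: D) (t - x i))
   + q ^+ #|D| * t *
     ((\prod_(i in D) (t - x i)) * \prod_(i in E :\: D) (t - q * x i)).
Proof.
move=> DE; rewrite /bracket !hornerE !hornerP.
have -> : \prod_(i in D) (q * t - x i) =
    q ^+ #|D| * \prod_(i in D) (t - q^-1 * x i).
  rewrite -prodr_const -big_split; apply: eq_bigr => i _ /=.
  by rewrite mulrBr mulVKf.
have -> : \prod_(i in E) (t - (if i \in D then q^-1 * x i else 1 * x i)) =
    (\prod_(i in D) (t - q^-1 * x i)) * \prod_(i in E :\: D) (t - x i).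
  rewrite -prod_subset_if //; apply: eq_bigr => i _; by case: ifP; rewrite ?mul1r.
have -> : \prod_(i in E) (t - (if i \in D then 1 * x i else q * x i)) =
    (\prod_(i in D) (t - x i)) * \prod_(i in E :\: D) (t - q * x i).
  rewrite -prod_subset_if //; apply: eq_bigr => i _; by case: ifP; rewrite ?mul1r.
by rewrite /=; ring.
Qed.

(** Its vanishing at [x e] is the identity for [e |: E] with the denominators x_e - x_i cleared. *)
Let interp x E : {poly F} :=
  \sum_(D : {set T} | D \subset E) hl_term q x E D *: bracket x E D
  - \prod_(i in E) ('X - (x i)%:P).

(** In [bracket], 'X multiplies a difference of two monic polynomials of degree #|E|, so no term of
    degree #|E| + 1 survives. *)
Let size_interp x E : (size (interp x E) <= #|E|.+1)%N.
Proof.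
apply: leq_trans (size_polyD _ _) _; rewrite geq_max size_polyN.
rewrite -[\prod_(i in E) _]big_enum size_prod_XsubC -cardE leqnn andbT.
apply: leq_trans (size_sum _ _ _) _; apply/bigmax_leqP => D _.
apply: leq_trans (size_scale_leq _ _) _.
apply: leq_trans (size_scale_leq _ _) _.
apply: leq_trans (size_polyD _ _) _; rewrite geq_max size_rootP leqnn /=.
apply: leq_trans (size_polyMleq _ _) _; rewrite size_polyX add2n ltnS.
by apply: size_monic_diff; rewrite ?rootP_monic ?size_rootP.
Qed.

(** At 0 every bracket is the product of the - x_i, so the identity for E itself gives this root. *)
Let interp0 x E : \sum_(D : {set T} | D \subset E) hl_term q x E D = 1 ->
  root (interp x E) 0.
Proof.
move=> sum1; rewrite rootE /interp hornerD hornerN horner_sum horner_prod.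
rewrite (eq_bigr (fun D => hl_term q x E D * \prod_(i in E) - x i)); last first.
  move=> D DE; rewrite hornerZ bracketE // !mulr0 mul0r addr0 subr0 mul1r.
  congr (_ * _); rewrite -prod_subset_if //.
  by apply: eq_bigr => i _; rewrite sub0r; case: ifP.
rewrite -mulr_suml sum1 mul1r subr_eq0; apply/eqP.
by apply: eq_bigr => i _; rewrite !hornerE.
Qed.

Let interp_node x E e : {in E &, injective x} -> e \in E ->
  root (interp x E) (x e).
Proof.
move=> xI eE; rewrite -(setD1K eE) in xI *.
set E1 := E :\ e in xI *; have eE1 : e \notin E1 by rewrite !inE eqxx.
rewrite rootE /interp hornerD hornerN horner_sum horner_prod.
rewrite [X in _ - X](bigD1 e) ?setU11 //= !hornerE subrr mul0r subr0.
rewrite sum_subsetU1 //; apply/eqP; apply: big1 => D DE.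
have eD : e \notin D by apply: contra eE1; exact: (subsetP DE).
have xe i : i \in E1 -> x i - x e != 0.
  move=> iE; rewrite subr_eq0; apply: contraNneq eE1 => /xI <- //.
    by rewrite inE iE orbT.
  by rewrite setU11.
rewrite (hornerZ (hl_term q x _ D)) (hornerZ (hl_term q x _ (e |: D))).
rewrite !bracketE ?setUS //; last by rewrite subsetU // DE orbT.
have -> : (e |: E1) :\: D = e |: (E1 :\: D).
  by rewrite setDUl; congr (_ :|: _); apply/setDidPl; rewrite disjoints1.
have -> : (e |: E1) :\: (e |: D) = E1 :\: D by rewrite -setDDl setU1K.
have eED : e \notin E1 :\: D by rewrite inE negb_and eE1 orbT.
rewrite hl_term_out // hl_term_in // cardsU1 eD add1n exprS.
(* At t = x_e one of the two products in each bracket contains t - x_e: only the second survives for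
   D, only the first for [e |: D]. *)
rewrite !big_setU1 //= subrr !(mul0r, mulr0, addr0, add0r).
set P := (\prod_(i in D) (x i - q * x e)) * \prod_(i in E1 :\: D) (x e - q * x i).
have E1P : (\prod_(i in D) ((x i - q * x e) / (x i - x e))) *
   ((\prod_(i in D) (x e - x i)) * \prod_(i in E1 :\: D) (x e - q * x i)) =
   (-1) ^+ #|D| * P.
  rewrite !mulrA; congr (_ * _); rewrite -prodr_const -!big_split /=.
  apply: eq_bigr => i iD; have := xe _ (subsetP DE _ iD) => h.
  by field.
have E2P : (\prod_(i in E1 :\: D) ((x e - q * x i) / (x e - x i))) *
   ((\prod_(i in D) (q * x e - x i)) * \prod_(i in E1 :\: D) (x e - x i)) =
   (-1) ^+ #|D| * P.
  rewrite mulrCA mulrA; rewrite [in RHS]mulrA -mulrA; congr (_ * _).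
    by rewrite -prodr_const -big_split /=; apply: eq_bigr => i _; ring.
  rewrite -big_split; apply: eq_bigr => i /setDP[iE _] /=; rewrite divfK //.
  by rewrite -opprB oppr_eq0 xe.
set c := hl_term q x E1 D.
(* Both surviving terms are multiples of the same product, with opposite factors x_e - q x_e and q
   x_e - x_e. *)
transitivity (c * (1 - x e) * q ^+ #|D| * x e * (x e - q * x e) *
   ((-1) ^+ #|D| * P) + c * (1 - x e) * q ^+ #|D| * x e * (q * x e - x e) *
   ((-1) ^+ #|D| * P)); last by ring.
rewrite -{1}E1P -E2P; ring.
Qed.

(** Zero and the nodes are #|E| + 1 distinct roots, more than the degree allows. *)
Let interp_eq0 x E : {in E &, injective x} -> {in E, forall i, x i != 0} ->
  \sum_(D : {set T} | D \subset E) hl_term q x E D = 1 -> interp x E = 0.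
Proof.
move=> xI x0 sum1; apply: (@roots_geq_poly_eq0 _ _ (0 :: [seq x i | i in E])).
- rewrite /= interp0 //; apply/allP => _ /imageP[i iE ->]; exact: interp_node.
- rewrite /=; apply/andP; split.
    by apply/imageP => -[i iE /esym/eqP]; apply/negP; exact: x0.
  by rewrite map_inj_in_uniq ?enum_uniq // => i j; rewrite !mem_enum; exact: xI.
- by rewrite /= size_image size_interp.
Qed.

(* Clearing denominators, the identity says that a polynomial in the value at a
   new point e vanishes; it has degree at most #|E|, and its roots are 0 and the
   other nodes, where the residues of D and e |: D cancel in pairs. *)
Lemma sum_hl_term x E : {in E &, injective x} -> {in E, forall i, x i != 0} ->
  \sum_(D : {set T} | D \subset E) hl_term q x E D = 1.
Proof.
have [n] := ubnP #|E|; elim: n E => // n IHn E; rewrite ltnS => En.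
have [->|[e eE]] := set_0Vmem E => xI x0.
  rewrite (eq_bigl (pred1 set0)); last by move=> D; rewrite subset0.
  by rewrite big_pred1_eq /hl_term setD0 cards0 !big_set0 hl_cross0l !mulr1.
rewrite -(setD1K eE) in xI x0 *; move: En; rewrite (cardsD1 e) eE add1n => En.
set E1 := E :\ e in xI x0 En *; have eE1 : e \notin E1 by rewrite !inE eqxx.
have E1E i : i \in E1 -> i \in e |: E1 by move=> iE; rewrite inE iE orbT.
have xI1 : {in E1 &, injective x} by move=> i j /E1E iE /E1E; exact: xI.
have x01 : {in E1, forall i, x i != 0} by move=> i /E1E; exact: x0.
have xe i : i \in E1 -> x i - x e != 0.
  move=> iE; rewrite subr_eq0; apply: contraNneq eE1 => /xI <- //; last exact: setU11.
  exact: E1E.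
have xe' i : i \in E1 -> x e - x i != 0 by move=> /xe; rewrite -opprB oppr_eq0.
have P0 : \prod_(i in E1) (x e - x i) != 0 by apply/prodf_neq0 => i /xe'.
(* By induction the polynomial of the smaller set E1 is zero, hence vanishes at the new node; the
   goal is this fact times the product of the x_e - x_i. *)
have := congr1 (fun p : {poly F} => p.[x e]) (interp_eq0 xI1 x01 (IHn _ En xI1 x01)).
rewrite horner0 /interp hornerD hornerN horner_sum horner_prod.
move=> /eqP; rewrite subr_eq0 => /eqP eqP1; apply: (mulIf P0).
rewrite mul1r; have -> : \prod_(i in E1) (x e - x i) = \prod_(i in E1) ('X - (x i)%:P).[x e].
  by apply: eq_bigr => i _; rewrite !hornerE.
rewrite -[RHS]eqP1 sum_subsetU1 // mulr_suml; apply: eq_bigr => D DE.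
rewrite hornerZ bracketE // hl_term_out // hl_term_in //.
have -> : \prod_(i in E1) ('X - (x i)%:P).[x e] = (\prod_(i in D) (x e - x i)) *
    \prod_(i in E1 :\: D) (x e - x i).
  rewrite -prod_subset_if //; apply: eq_bigr => i _; rewrite !hornerE.
  by case: ifP.
have -> : \prod_(i in D) (q * x e - x i) =
   (\prod_(i in D) ((x i - q * x e) / (x i - x e))) * \prod_(i in D) (x e - x i).
  rewrite -big_split; apply: eq_bigr => i iD /=.
  by have h := xe _ (subsetP DE _ iD); field.
have -> : \prod_(i in E1 :\: D) (x e - q * x i) =
   (\prod_(i in E1 :\: D) ((x e - q * x i) / (x e - x i))) *
   \prod_(i in E1 :\: D) (x e - x i).
  rewrite -big_split; apply: eq_bigr => i /setDP[iE _] /=.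
  by rewrite divfK ?xe'.
ring.
Qed.

End Interpolation.

(** * The coefficients of the right-hand side and their recursion *)

Lemma bin2D m k : 'C(m + k, 2) = ('C(m, 2) + m * k + 'C(k, 2))%N.
Proof.
elim: k => [|k IHk]; first by rewrite addn0 muln0 !addn0.
by rewrite addnS !binS !bin1 IHk mulnS; ring.
Qed.

Section ClosedForm.
Variables (T : finType) (F : fieldType) (q : F).
Implicit Types (x y : T -> F) (A B D E I J K L : {set T}).

(** Singletons B make 1 - x_i q^N invertible, and general B make [hl_coef q x B - 1] nonzero.
    Allowing every N makes the condition stable under scaling x by a power of q. *)
Definition generic x := [/\ injective x, forall i, x i != 0 &
  forall (B : {set T}) N, B != set0 -> q ^+ N * \prod_(i in B) x i != 1].

Definition hl_coef x B := q ^+ 'C(#|B|, 2) * \prod_(i in B) x i.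

(* Every factor has I nonempty, so #|I|.-1 is the honest #|I| - 1. *)
Definition hl_pole x I := \prod_(i in I) (1 - (x i * q ^+ #|I|.-1)^-1)^-1.

Definition hl_residue x I J :=
  hl_pole x I * (\prod_(j in J) (1 - x j * q ^+ #|I|)^-1) * hl_cross q x I J.

(** The coefficient of u^k on the right-hand side for the variables in A: a factor 1/(1 - u c)
    contributes c^k. *)
Definition hl_closed x k A :=
  \sum_(I : {set T} | I \subset A) hl_coef x I ^+ k * hl_residue x I (A :\: I).

(** Unfolded, this is a sum over weakly decreasing chains of k subsets of A. *)
Fixpoint hl_rec x k A := if k is k'.+1 then
  \sum_(B : {set T} | B \subset A)
    hl_coef x B * hl_cross q x B (A :\: B) * hl_rec x k' B
  else 1.

Hypothesis q0 : q != 0.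

Lemma generic_scale x m : generic x -> generic (fun i => q ^+ m * x i).
Proof.
case=> xI x0 xB; have qm := expf_neq0 m q0; split.
- by move=> i j /(mulfI qm) /xI.
- by move=> i; rewrite mulf_neq0.
- move=> B N B0; rewrite big_split /= prodr_const -exprM mulrA -exprD; exact: xB.
Qed.

Lemma generic1 x N i : generic x -> 1 - x i * q ^+ N != 0.
Proof.
case=> _ _ xB; rewrite subr_eq0 eq_sym mulrC.
have /(_ N) := xB [set i]; rewrite big_set1; apply.
by apply/set0Pn; exists i; rewrite set11.
Qed.

Lemma hl_coefU x I D : [disjoint I & D] ->
  hl_coef x (I :|: D) = hl_coef x I * hl_coef (fun i => q ^+ #|I| * x i) D.
Proof.
move=> ID; rewrite /hl_coef prod_disjointU // big_split /= prodr_const.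
rewrite cardsU disjoint_setI0 // cards0 subn0 bin2D !exprD -exprM; ring.
Qed.

Lemma disjointDr A B : [disjoint A & B :\: A].
Proof. by rewrite -setI_eq0 setIDA setIC setDIl setDv setI0. Qed.

Lemma setDU_sub A I D : I \subset A -> D \subset A :\: I ->
  [/\ [disjoint I & D], [disjoint D & A :\: (I :|: D)],
   (I :|: D) :\: I = D & A :\: I = D :|: (A :\: (I :|: D))].
Proof.
move=> IA /subsetDP[DA DI]; split.
- by rewrite disjoint_sym.
- by rewrite disjoint_sym -setDDl disjoints_subset subsetDr.
- by rewrite setDUl setDv set0U; apply/setDidPl.
- rewrite -setDDl -{1}(setID (A :\: I) D); congr (_ :|: _).
  by apply/setIidPr; rewrite subsetD DA DI.
Qed.

Lemma hl_closed_rec x k A : generic x -> hl_closed x k.+1 A =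
  \sum_(B : {set T} | B \subset A)
    hl_coef x B * hl_cross q x B (A :\: B) * hl_closed x k B.
Proof.
move=> gx; have [xI x0 _] := gx; rewrite /hl_closed.
under [RHS]eq_bigr => B _ do rewrite big_distrr /=.
rewrite sum_subset_flag; apply: eq_bigr => I IA.
set E := A :\: I; set y := fun i => q ^+ #|I| * x i.
have gy : generic y := generic_scale _ gx; have [yI y0 _] := gy.
(* The identity at y = q^#|I| x is inserted as a factor 1. Its factors 1 - y_j, for j in E - D,
   cancel part of the residue of I in A and leave the residue of I inside B = I + D. *)
rewrite exprSr -[LHS]mulr1.
rewrite -[X in _ * X = _](@sum_hl_term _ _ _ q0 y E (in2W yI) (in1W y0)).
rewrite big_distrr /=.
apply: eq_bigr => D DE; have [dID dDA IDI AE] := setDU_sub IA DE.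
rewrite hl_coefU // IDI /hl_residue /hl_term hl_cross_scale ?expf_neq0 //.
have -> : E :\: D = A :\: (I :|: D) by rewrite setDDl.
rewrite /E AE prod_disjointU // hl_crossUr // hl_crossUl //.
have -> : \prod_(j in A :\: (I :|: D)) (1 - x j * q ^+ #|I|)^-1 =
    (\prod_(j in A :\: (I :|: D)) (1 - y j))^-1.
  by rewrite -prodfV; apply: eq_bigr => j _; rewrite /y mulrC.
have P0 : \prod_(j in A :\: (I :|: D)) (1 - y j) != 0.
  by apply/prodf_neq0 => j _; have := generic1 0 j gy; rewrite mulr1.
rewrite /hl_coef -/y; field; exact: P0.
Qed.

(** The balance of exponents of q when D, of size k, is replaced by its complement in L, of size
    m. *)
Lemma bin2_compl m k : ('C(m, 2) + k * (m + k).-1 = 'C(m + k, 2) + 'C(k, 2))%N.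
Proof.
rewrite bin2D -!addnA addnn -mul2n -mul_bin_diag bin1; congr (_ + _)%N.
by case: k => [|k]; rewrite ?muln0 //= addnS /= mulnDr mulnC.
Qed.

(** This is [sum_hl_term] at z_i = 1/(q^(#|L| - 1) x_i), indexed by the complement D = L - I:
    inversion swaps the two sides of [hl_cross], and [bin2_compl] adjusts the powers of q. *)
Lemma sum_hl_pole x L : generic x ->
  \sum_(I : {set T} | I \subset L)
    hl_coef x I * hl_cross q x I (L :\: I) *
    \prod_(i in L :\: I) (1 - (x i * q ^+ #|L|.-1)^-1)^-1 =
  hl_coef x L * hl_pole x L.
Proof.
move=> gx; set m := #|L|.-1; set y := fun i => q ^+ m * x i.
have gy : generic y := generic_scale _ gx; have [yI y0 _] := gy.
set z := fun i => (y i)^-1.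
have zI : {in L &, injective z} by move=> i j _ _ /invr_inj /yI.
have z0 : {in L, forall i, z i != 0} by move=> i _; rewrite invr_eq0.
have z1 i : 1 - z i != 0.
  have := generic1 0 i gy; rewrite mulr1 /z !subr_eq0; apply: contraNneq.
  by move=> h; rewrite -[y i]invrK -h invr1.
have xz i : (x i * q ^+ m)^-1 = z i by rewrite /z /y mulrC.
rewrite sum_subset_compl -[RHS]mulr1 -[X in _ = _ * X](sum_hl_term q0 zI z0).
rewrite big_distrr /=.
apply: eq_bigr => D DL.
rewrite setDDr setDv set0U (setIidPr DL).
have -> : \prod_(i in D) (1 - (x i * q ^+ m)^-1)^-1 = (\prod_(i in D) (1 - z i))^-1.
  by rewrite -prodfV; apply: eq_bigr => i _; rewrite xz.
have -> : hl_pole x L = (\prod_(i in D) (1 - z i))^-1 *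
    (\prod_(i in L :\: D) (1 - z i))^-1.
  rewrite -!prodfV -prod_disjointU ?disjointDr // -{1}(setIidPr DL) setID.
  by apply: eq_bigr => i _; rewrite -/m xz.
have -> : hl_coef x (L :\: D) = hl_coef x L * (q ^+ 'C(#|D|, 2) * \prod_(i in D) z i).
  rewrite /hl_coef prodfV /y big_split /= prodr_const -exprM.
  rewrite [in RHS](big_setID D) /= (setIidPr DL).
  have P0 : \prod_(i in D) x i != 0 by case: gx => _ x0 _; apply/prodf_neq0.
  have Q0 := expf_neq0 (m * #|D|) q0.
  have : q ^+ 'C(#|L :\: D|, 2) * q ^+ (m * #|D|) = q ^+ 'C(#|L|, 2) * q ^+ 'C(#|D|, 2).
    have cL : #|L| = (#|L :\: D| + #|D|)%N.
      by rewrite -(cardsID D L) (setIidPr DL) addnC.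
    by rewrite -!exprD; congr (q ^+ _); rewrite cL -bin2_compl /m cL mulnC.
  move=> h; apply: (mulIf Q0); rewrite mulrAC h; field.
  by rewrite P0 Q0.
rewrite /hl_term /z hl_cross_inv // /y hl_cross_scale ?expf_neq0 // -/z.
have P0 : \prod_(j in L :\: D) (1 - z j) != 0 by apply/prodf_neq0.
have P1 : \prod_(j in D) (1 - z j) != 0 by apply/prodf_neq0.
by field; rewrite P0 P1.
Qed.

(** Each [hl_coef q x L * hl_pole q x L] is expanded over I in L by [sum_hl_pole]. For fixed I, the
    sets L - I run over the subsets of A - I and form a closed form in the variables q^#|I| x. *)
Lemma hl_closed1 x A : generic x -> hl_closed x 1 A =
  \sum_(I : {set T} | I \subset A) hl_coef x I * hl_cross q x I (A :\: I) *
    hl_closed (fun i => q ^+ #|I| * x i) 0 (A :\: I).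
Proof.
move=> gx; rewrite /hl_closed.
under [RHS]eq_bigr => I _ do rewrite big_distrr /=.
(* The right-hand side is regrouped over flags I in B in A, where B - I is the summation set of the
   inner closed form. *)
rewrite -[RHS](_ : \sum_(B : {set T} | B \subset A) \sum_(I : {set T} | I \subset B)
   hl_coef x I * hl_cross q x I (A :\: I) * (hl_coef (fun i => q ^+ #|I| * x i) (B :\: I) ^+ 0 *
    hl_residue (fun i => q ^+ #|I| * x i) (B :\: I) ((A :\: I) :\: (B :\: I))) = _); last first.
  rewrite sum_subset_flag; apply: eq_bigr => I IA; apply: eq_bigr => D DE.
  by have [_ _ -> _] := setDU_sub IA DE.
apply: eq_bigr => L LA.
rewrite /hl_residue expr1 !mulrA -sum_hl_pole // !mulr_suml.
apply: eq_bigr => I IL; have IA := subset_trans IL LA.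
have DE : L :\: I \subset A :\: I by rewrite setSD.
have [dID dDA _ AE] := setDU_sub IA DE.
have IDL : I :|: (L :\: I) = L by rewrite -{1}(setIidPr IL) setID.
rewrite IDL in AE dDA; rewrite hl_cross_scale ?expf_neq0 // expr0 mul1r.
have -> : (A :\: I) :\: (L :\: I) = A :\: L by rewrite setDDl IDL.
have -> : hl_cross q x L (A :\: L) =
    hl_cross q x I (A :\: L) * hl_cross q x (L :\: I) (A :\: L).
  by rewrite -hl_crossUl // IDL.
rewrite AE hl_crossUr //.
have cL : #|L| = (#|I| + #|L :\: I|)%N.
  by rewrite -(cardsID I L) (setIidPr IL).
have -> : hl_pole (fun i => q ^+ #|I| * x i) (L :\: I) =
    \prod_(i in L :\: I) (1 - (x i * q ^+ #|L|.-1)^-1)^-1.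
  apply: eq_bigr => i iLI; congr (1 - _^-1)^-1.
  (* Since L - I contains i, the predecessor is not truncated and #|I| + (#|L - I| - 1) = #|L| -
     1. *)
  have K0 : (0 < #|L :\: I|)%N by apply/card_gt0P; exists i.
  rewrite cL -(prednK K0) addnS /= exprD; ring.
have -> : \prod_(j in A :\: L) (1 - q ^+ #|I| * x j * q ^+ #|L :\: I|)^-1 =
    \prod_(j in A :\: L) (1 - x j * q ^+ #|L|)^-1.
  apply: eq_bigr => j _; congr (1 - _)^-1; rewrite cL exprD; ring.
ring.
Qed.

Lemma hl_coef_set0 x : hl_coef x set0 = 1.
Proof. by rewrite /hl_coef cards0 big_set0 mul1r. Qed.

(* Evaluating [hl_closed x 1 A] by [hl_closed_rec] and by [hl_closed1] and
   using the induction hypothesis on the proper subsets of A leaves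
   (hl_coef x A - 1) * (hl_closed x 0 A - 1) = 0. *)
Lemma hl_closed0 x A : generic x -> hl_closed x 0 A = 1.
Proof.
have [n] := ubnP #|A|; elim: n A x => // n IHn A x; rewrite ltnS => An gx.
have [->|A0] := eqVneq A set0.
  rewrite /hl_closed (eq_bigl (pred1 set0)); last by move=> D; rewrite subset0.
  rewrite big_pred1_eq expr0 /hl_residue /hl_pole setD0 !big_set0.
  by rewrite hl_cross0l !mulr1.
have c1 : hl_coef x A - 1 != 0.
  by rewrite subr_eq0; case: gx => _ _; apply.
have := hl_closed1 A gx; rewrite hl_closed_rec //.
rewrite (bigD1 A) //= [in RHS](bigD1 set0) ?sub0set //=.
rewrite cards0 setDv setD0 hl_cross0r hl_cross0l hl_coef_set0 !mul1r mulr1.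
have -> : hl_closed (fun i => q ^+ 0 * x i) 0 A = hl_closed x 0 A.
  by congr hl_closed; apply/funext => i; rewrite mul1r.
(* By induction all other terms on either side are values of f, so the two remainders are one and
   the same sum, without its term at A (equal to [hl_coef q x A]) or its term at [set0] (equal to
   1). *)
pose f B := hl_coef x B * hl_cross q x B (A :\: B).
rewrite (eq_bigr f); last first.
  move=> B /andP[BA BnA]; rewrite IHn ?mulr1 //.
  apply: leq_trans An; apply: proper_card.
  by rewrite properEneq BnA BA.
rewrite [in RHS](eq_bigr f); last first.
  move=> B /andP[BA B0]; rewrite IHn ?mulr1 //; last exact: generic_scale.
  apply: leq_trans An; apply: proper_card; rewrite properE subsetDl /=.
  have /set0Pn[b bB] := B0; apply/subsetPn; exists b; first exact: (subsetP BA).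
  by rewrite inE bB.
have s1 : \sum_(B : {set T} | B \subset A) f B =
    hl_coef x A + \sum_(B : {set T} | (B \subset A) && (B != A)) f B.
  by rewrite (bigD1 A) //= /f setDv hl_cross0r mulr1.
have s2 : \sum_(B : {set T} | B \subset A) f B =
    1 + \sum_(B : {set T} | (B \subset A) && (B != set0)) f B.
  by rewrite (bigD1 set0) ?sub0set //= /f hl_coef_set0 hl_cross0l mulr1.
set a := \sum_(B | _ && (_ != A)) f B in s1 *.
set b := \sum_(B | _ && (_ != set0)) f B in s2 *.
move: s1; rewrite {}s2 => s12 eqR; apply/eqP; rewrite -subr_eq0.
rewrite -(mulrI_eq0 _ (mulfI c1)); apply/eqP.
have -> : (hl_coef x A - 1) * (hl_closed x 0 A - 1) =
   (hl_coef x A * hl_closed x 0 A + a) - (hl_closed x 0 A + b).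
  have -> : b = hl_coef x A + a - 1 by rewrite -s12; ring.
  ring.
by rewrite eqR subrr.
Qed.

Lemma hl_closedE x k A : generic x -> hl_rec x k A = hl_closed x k A.
Proof.
move=> gx; elim: k A => [|k IHk] A; first by rewrite hl_closed0.
by rewrite hl_closed_rec //=; apply: eq_bigr => B _; rewrite IHk.
Qed.

End ClosedForm.

(** * Exponent functions as chains of superlevel sets *)

Section Levels.
Variables (T : finType) (F : fieldType) (q : F) (x : T -> F).
Implicit Types (A B : {set T}) (f : T -> nat).

(* A chain of subsets is encoded by the function f whose superlevel sets
   [r < f] (r < k) are its members. *)
Definition level_term k A f :=
  q ^+ (\sum_(r < k) 'C(#|[set i | (r < f i)%N]|, 2)) *
  (\prod_i x i ^+ f i) *
  \prod_(i in A) \prod_(j in A | (f j < f i)%N) ((x i - q * x j) / (x i - x j)).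

Definition positivity f := [set i | (0 < f i)%N].

(** Raising f by one on B puts B in front of its chain. A strict descent of the new function either
    goes from B to A - B, which gives [hl_cross], or is a descent of f within B. *)
Lemma level_termS k A B f : B \subset A -> positivity f \subset B ->
  level_term k.+1 A (fun i => if i \in B then (f i).+1 else 0%N) =
  hl_coef q x B * hl_cross q x B (A :\: B) * level_term k B f.
Proof.
move=> BA fB; set g := fun i => _.
have f0 i : i \notin B -> f i = 0%N.
  by move=> iB; apply/eqP; rewrite -leqn0 leqNgt; apply: contra iB => fi;
     apply: (subsetP fB); rewrite inE.
have gin i : i \in B -> g i = (f i).+1 by rewrite /g => ->.
have gout i : i \notin B -> g i = 0%N by rewrite /g => /negPf->.
have expE : (\sum_(r < k.+1) 'C(#|[set i | (r < g i)%N]|, 2) =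
    'C(#|B|, 2) + \sum_(r < k) 'C(#|[set i | (r < f i)%N]|, 2))%N.
  rewrite big_ord_recl; congr (_ + _)%N.
    congr 'C(_, 2); apply: eq_card => i; rewrite inE /g /=; by case: ifP.
  apply: eq_bigr => r _; congr 'C(_, 2); apply: eq_card => i; rewrite !inE /g /=.
  by case: ifPn => // /f0 ->.
have xE : \prod_i x i ^+ g i = (\prod_(i in B) x i) * \prod_i x i ^+ f i.
  rewrite [X in _ = X * _]big_mkcond -big_split; apply: eq_bigr => i _ /=.
  by rewrite /g; case: ifPn => [_|/f0 ->]; rewrite ?exprS ?mul1r.
have pairE : \prod_(i in A) \prod_(j in A | (g j < g i)%N)
      ((x i - q * x j) / (x i - x j)) =
    hl_cross q x B (A :\: B) *
    \prod_(i in B) \prod_(j in B | (f j < f i)%N) ((x i - q * x j) / (x i - x j)).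
  rewrite (big_setID B) /= (setIidPr BA) mulrC big1 ?mul1r.
    rewrite -big_split; apply: eq_bigr => i iB /=.
    rewrite big_mkcondr (big_setID B) /= (setIidPr BA) mulrC; congr (_ * _).
      by apply: eq_bigr => j /setDP[_ jB]; rewrite (gin i) // (gout j).
    rewrite [RHS]big_mkcondr; apply: eq_bigr => j jB.
    by rewrite !gin.
  move=> i /setDP[_ iB]; apply: big1 => j; by rewrite (gout i) // ltn0 andbF.
rewrite /level_term expE xE pairE exprD /hl_coef; ring.
Qed.

Lemma sum_level_term k A :
  \sum_(f : {ffun T -> 'I_k.+1} | positivity (fun i => f i) \subset A)
    level_term k A (fun i => f i) =
  hl_rec q x k A.
Proof.
elim: k A => [|k IHk] A /=.
  pose f0 : {ffun T -> 'I_1} := [ffun => ord0].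
  rewrite (eq_bigl (pred1 f0)) => [|f]; last first.
    have -> : f = f0 by apply/ffunP => i; rewrite ffunE ord1.
    by rewrite /= eqxx; apply/subsetP => i; rewrite inE ffunE.
  rewrite big_pred1_eq /level_term big_ord0 expr0 mul1r !big1 ?mulr1 //.
    by move=> i _; apply: big1 => j; rewrite !ffunE andbF.
  by move=> i _; rewrite ffunE.
rewrite (partition_big (fun f : {ffun T -> 'I_k.+2} => positivity (fun i => f i))
  (fun B => B \subset A)) //=; apply: eq_bigr => B BA.
rewrite -IHk big_distrr /=.
(* Functions with positivity set B correspond to functions supported in B and bounded by one less,
   by adding or subtracting 1 on B. *)
pose up (g : {ffun T -> 'I_k.+1}) : {ffun T -> 'I_k.+2} :=
  [ffun i => if i \in B then lift ord0 (g i) else ord0].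
pose down (f : {ffun T -> 'I_k.+2}) : {ffun T -> 'I_k.+1} :=
  [ffun i => inord (f i).-1].
have upE g i : up g i = (if i \in B then (g i).+1 else 0%N) :> nat.
  by rewrite ffunE; case: ifP.
have downE (f : {ffun T -> _}) i : down f i = (f i).-1 :> nat.
  by rewrite ffunE inordK // ltnS; have := ltn_ord (f i); case: (nat_of_ord _).
rewrite (reindex_onto up down) /=; last first.
  move=> f /andP[_ /eqP fB]; apply/ffunP => i; apply: val_inj => /=.
  by rewrite upE downE -fB inE; case: (nat_of_ord (f i)).
apply: eq_big => [g|g gB].
  have -> : positivity (fun i => up g i) = B.
    by apply/setP => i; rewrite inE upE; case: ifP.
  rewrite BA eqxx /=; apply/eqP/subsetP => [<- i|gB].
    by rewrite inE downE upE; case: ifP.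
  apply/ffunP => i; apply: val_inj; rewrite /= downE upE.
  by case: ifPn => //; apply: contraNeq => gi; apply: gB; rewrite inE lt0n eq_sym.
have {}gB : positivity (fun i => g i) \subset B.
  have /andP[_ /eqP <-] := gB.
  by apply/subsetP => i; rewrite inE downE upE; case: ifP.
rewrite -level_termS //; congr level_term; apply/funext => i; exact: upE.
Qed.

End Levels.

(** * The statistic n(lambda), column by column *)

Lemma partition_nth_leq l i j : is_partition l -> (i <= j)%N ->
  (nth 0 l j <= nth 0 l i)%N.
Proof.
by move=> pl ij; rewrite leqNgt; apply/negP => /(part_gt_index pl); rewrite ltnNge ij.
Qed.

Lemma partition_nth_bound l k i : is_partition l -> (head 0 l <= k)%N ->
  (nth 0 l i <= k)%N.
Proof. by move=> pl; apply: leq_trans; rewrite -nth0 partition_nth_leq. Qed.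

(** The indices satisfying P form an initial segment 0, ..., c - 1, whose sum is C(c, 2). *)
Lemma sum_index_downset (P : pred nat) n :
  (forall i j, (i <= j)%N -> P j -> P i) ->
  (\sum_(i < n | P i) i = 'C(\sum_(i < n | P i) 1, 2))%N.
Proof.
move=> Pd; elim: n => [|n IHn]; first by rewrite !big_ord0.
have recr (F : nat -> nat) : (\sum_(i < n.+1 | P i) F i =
    \sum_(i < n | P i) F i + if P n then F n else 0)%N.
  by rewrite big_mkcond big_ord_recr -big_mkcond.
rewrite (recr id) (recr (fun=> 1%N)) /= IHn.
have [Pn|_] := boolP (P n); last by rewrite !addn0.
suff -> : (\sum_(i < n | P i) 1 = n)%N by rewrite addn1 binS bin1 addnC.
rewrite -[RHS]card_ord -sum1_card; apply: eq_bigl => i.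
by apply: (Pd _ n) => //; apply: ltnW.
Qed.

(** Each part is the number of columns r < k that meet its row. Exchanging the sums, a column
    contributes the sum of its row indices, which start at 0. *)
Lemma partition_n_columns l n k :
  is_partition l -> (head 0 l <= k)%N -> (size l <= n)%N ->
  partition_n l = (\sum_(r < k) 'C(#|[set i : 'I_n | (r < nth 0 l i)%N]|, 2))%N.
Proof.
move=> pl hl sl; rewrite /partition_n.
rewrite (big_ord_widen n (fun i => i * nth 0 l i)%N) // big_mkcond /=.
transitivity (\sum_(i < n) \sum_(r < k | (r < nth 0 l i)%N) i)%N.
  apply: eq_bigr => i _; rewrite sum_nat_const mulnC.
  have -> : #|[pred r : 'I_k | (r < nth 0 l i)%N]| = nth 0 l i.
    rewrite -sum1_card -(big_ord_widen k (fun=> 1%N)) ?partition_nth_bound //.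
    by rewrite sum_nat_const card_ord muln1.
  by case: ifPn => // ; rewrite -leqNgt => /(nth_default 0) ->; rewrite mul0n.
rewrite (exchange_big_dep predT) //=; apply: eq_bigr => r _.
rewrite (sum_index_downset (P := fun i => r < nth 0 l i)%N); last first.
  by move=> i j ij; move/leq_trans; apply; apply: partition_nth_leq.
by rewrite -sum1_card; congr 'C(_, 2); apply: eq_bigl => i; rewrite inE.
Qed.

(** * Hall-Littlewood polynomials as sums over rearrangements *)

Section Rearrangements.
Variables (F : fieldType) (n : nat) (q : F) (x : 'I_n -> F).

Definition rearranges (f : 'I_n -> nat) l :=
  [exists w : 'S_n, [forall i : 'I_n, f (w i) == nth 0%N l i]].

Lemma rearrangesP f l :
  reflect (exists w : 'S_n, forall i : 'I_n, f (w i) = nth 0%N l i)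
          (rearranges f l).
Proof.
by apply: (iffP existsP) => -[w wP]; exists w; first (by move=> i; apply/eqP/(forallP wP));
  apply/forallP => i; rewrite wP.
Qed.

Lemma level_term_hl l k f (w : 'S_n) :
  is_partition l -> (head 0 l <= k)%N -> (size l <= n)%N ->
  (forall i : 'I_n, f (w i) = nth 0%N l i) ->
  level_term q x k [set: 'I_n] f =
  q ^+ partition_n l * hall_littlewood_term q x l w.
Proof.
move=> pl hl sl fw; rewrite /level_term /hall_littlewood_term -mulrA.
congr (q ^+ _ * (_ * _)).
- rewrite (partition_n_columns pl hl sl); apply: eq_bigr => r _; congr 'C(_, 2).
  rewrite -(card_preimset _ (@perm_inj _ w)); apply: eq_card => i.
  by rewrite !inE fw.
- by rewrite (reindex_inj (@perm_inj _ w)); apply: eq_bigr => i _; rewrite fw.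
rewrite (reindex_inj (@perm_inj _ w)); apply: eq_big => [i|i _]; first by rewrite inE.
rewrite (reindex_inj (@perm_inj _ w)); apply: eq_bigl => j.
rewrite inE /= !fw; apply/esym/andb_idl; exact: part_gt_index.
Qed.

(** Cosets of the stabilizer of l correspond to its distinct rearrangements, C going to l composed
    with the inverse of a representative; [level_term_hl] matches the terms. *)
Lemma hall_littlewood_levels l k :
  is_partition l -> (head 0 l <= k)%N -> (size l <= n)%N ->
  q ^+ partition_n l * hall_littlewood q x l =
  \sum_(f : {ffun 'I_n -> 'I_k.+1} | rearranges (fun i => f i) l)
    level_term q x k [set: 'I_n] (fun i => f i).
Proof.
move=> pl hl sl; rewrite /hall_littlewood sl big_distrr /=.
pose rep C i := nth 0%N l ((repr C : 'S_n)^-1%g i).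
pose fC (C : {set 'S_n}) : {ffun 'I_n -> 'I_k.+1} := [ffun i => inord (rep C i)].
have fCE C i : fC C i = rep C i :> nat.
  by rewrite ffunE inordK // ltnS partition_nth_bound.
have fC_repr C (i : 'I_n) : fC C (repr C i) = nth 0%N l i :> nat.
  by rewrite fCE /rep permK.
have fC_inj : {in rcosets (part_stab n l) [set: 'S_n] &, injective fC}.
  move=> _ _ /rcosetsP[v _ ->] /rcosetsP[w _ ->] fvw.
  rewrite -(rcoset_repr (part_stab_group n l) v) -(rcoset_repr (part_stab_group n l) w).
  apply/rcoset_eqP; rewrite mem_rcoset inE; apply/forallP => i; apply/eqP.
  rewrite permM -[LHS]/(rep _ _) -fCE -fvw fC_repr //.
transitivity (\sum_(C in rcosets (part_stab n l) [set: 'S_n])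
    level_term q x k [set: 'I_n] (fun i => fC C i)).
  apply: eq_bigr => C _; apply/esym/level_term_hl => //; exact: fC_repr.
rewrite -(big_imset (fun f : {ffun 'I_n -> 'I_k.+1} =>
  level_term q x k [set: 'I_n] (fun i => f i)) fC_inj) /=.
apply: eq_bigl => f; apply/imsetP/rearrangesP => [[C _ ->]|[w fw]].
  by exists (repr C) => i; rewrite fC_repr.
exists (part_stab n l :* w)%g; first by apply/rcosetsP; exists w; rewrite ?inE.
apply/ffunP => i; apply: val_inj; rewrite /= fCE /rep.
(* The representative is v * w with v in the stabilizer, so it yields the same rearrangement as
   w. *)
have /rcosetP[v] := mem_repr_rcoset (part_stab_group n l) w.
rewrite inE => /forallP vl ->; rewrite invMg permM.
by rewrite -(eqP (vl _)) permKV -fw permKV.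
Qed.

Definition sorted_parts (f : 'I_n -> nat) :=
  [seq a <- sort geq [seq f i | i <- enum 'I_n] | a != 0%N].

Lemma sorted_geq_zeros s : sorted geq s ->
  s = [seq a <- s | a != 0%N] ++ nseq (count_mem 0%N s) 0%N.
Proof.
elim: s => // a s IHs /= p; have /IHs := path_sorted p.
have [a0|a0 {1}->//] := eqVneq a 0%N.
have s0 : {in s, forall b, b = 0%N}.
  have tr : transitive geq by move=> c d e /= cd de; apply: leq_trans de cd.
  move=> b bs; have /allP/(_ _ bs) := order_path_min tr p.
  by rewrite a0 /= leqn0 => /eqP.
rewrite (@eq_in_filter _ _ pred0) ?filter_pred0 /=; last by move=> b /s0 ->.
by rewrite a0 /= add0n => {1}->.
Qed.

Lemma sorted_parts_partition f : is_partition (sorted_parts f).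
Proof.
apply/andP; split; last by rewrite mem_filter.
apply: sorted_filter; first by move=> c d e /= cd de; apply: leq_trans de cd.
by apply: sort_sorted => a b; apply: leq_total.
Qed.

Lemma size_sorted_parts f : (size (sorted_parts f) <= n)%N.
Proof.
by rewrite size_filter (leq_trans (count_size _ _)) // size_sort size_map size_enum_ord.
Qed.

Lemma head_sorted_parts f k : (forall i, f i <= k)%N ->
  (head 0%N (sorted_parts f) <= k)%N.
Proof.
move=> fk; case E: (sorted_parts f) => [//|a s] /=.
have : a \in sorted_parts f by rewrite E mem_head.
by rewrite mem_filter mem_sort => /andP[_ /mapP[i _ ->]].
Qed.

Lemma nth_cat_nseq s m i : nth 0%N (s ++ nseq m 0%N) i = nth 0%N s i.
Proof.
rewrite nth_cat; case: ltnP => // si; rewrite nth_nseq (nth_default _ si).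
by case: ifP.
Qed.

(** Padded by zeros to length n, l is a decreasing rearrangement of the values of f, and there is
    only one. *)
Lemma rearrangesE f l : is_partition l -> (size l <= n)%N ->
  rearranges f l = (l == sorted_parts f).
Proof.
move=> pl sl; have sg : sorted geq (sort geq [seq f i | i <- enum 'I_n]).
  by apply: sort_sorted => a b; apply: leq_total.
have tr : transitive geq by move=> c d e /= cd de; apply: leq_trans de cd.
have as_ : antisymmetric geq by move=> a b; rewrite andbC; exact: anti_leq.
apply/rearrangesP/eqP => [[w fw]|lE].
  have E : l ++ nseq (n - size l) 0%N = [seq f (w i) | i <- enum 'I_n].
    apply: (@eq_from_nth _ 0%N).
      by rewrite size_cat size_nseq size_map size_enum_ord subnKC.
    move=> i; rewrite size_cat size_nseq subnKC // => i_n.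
    rewrite nth_cat_nseq (nth_map (Ordinal i_n)) ?size_enum_ord //.
    by rewrite fw nth_enum_ord.
  have lf : l = [seq a <- l ++ nseq (n - size l) 0%N | a != 0%N].
    rewrite filter_cat (_ : [seq a <- nseq _ _ | _] = [::]) ?cats0; last first.
      by elim: (n - size l)%N.
    apply/esym/all_filterP/allP => a al.
    by case/andP: pl => _; apply: contraNneq => <-.
  rewrite lf E /sorted_parts; congr filter; apply: (sorted_eq tr as_) => //.
    rewrite -E; apply/(sortedP 0%N) => i _.
    by rewrite !nth_cat_nseq; apply: partition_nth_leq.
  rewrite perm_sym perm_sort (map_comp f w) perm_map // uniq_perm ?enum_uniq //.
    by rewrite map_inj_uniq ?enum_uniq //; exact: perm_inj.
  move=> i; rewrite mem_enum; apply/esym/mapP; exists (w^-1 i)%g; rewrite ?mem_enum //.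
  by rewrite permKV.
have sz : size (sort geq [seq f i | i <- enum 'I_n]) == n.
  by rewrite size_sort size_map size_enum_ord.
have pe : perm_eq (Tuple sz) [tuple f i | i < n] by rewrite /= perm_sort.
have /tuple_permP[w /= wE] := pe; exists w => i.
have -> : nth 0%N l i = nth 0%N (sort geq [seq f i | i <- enum 'I_n]) i.
  by rewrite [in RHS](sorted_geq_zeros sg) nth_cat_nseq lE.
rewrite wE (nth_map i) ?size_enum_ord // nth_ord_enum.
by rewrite tnth_mktuple.
Qed.

(** Every f from [n] to [0, k] rearranges exactly one partition, [sorted_parts f], so the sums over
    rearrangements combine into the sum over all f. *)
Lemma sum_hall_littlewood k :
  \sum_(l \in [set l : seq nat | is_partition l && (head 0%N l <= k)%N]%classic)
     q ^+ partition_n l * hall_littlewood q x l =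
  hl_rec q x k [set: 'I_n].
Proof.
rewrite -sum_level_term.
pose sp (f : {ffun 'I_n -> 'I_k.+1}) := sorted_parts (fun i => f i).
pose r := undup [seq sp f | f <- enum {ffun 'I_n -> 'I_k.+1}].
have rP l : l \in r -> [/\ is_partition l, (head 0 l <= k)%N & (size l <= n)%N].
  rewrite mem_undup => /mapP[f _ ->]; split.
  - exact: sorted_parts_partition.
  - by apply: head_sorted_parts => i; rewrite -ltnS.
  - exact: size_sorted_parts.
have rsp f : sp f \in r by rewrite mem_undup map_f // mem_enum.
rewrite (fsbigE r) ?undup_uniq //=; first last.
(* Outside r the terms vanish: by convention if l has more than n parts, and otherwise because no f
   rearranges l. *)
- move=> l /andP[pl hl] lr; rewrite /hall_littlewood; case: ifP => [sl|_]; last first.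
    by rewrite mulr0.
  have := hall_littlewood_levels pl hl sl; rewrite /hall_littlewood sl => ->.
  apply: big1 => f; rewrite rearrangesE // => /eqP lE.
  by case/negP: lr; rewrite lE rsp.
- by move=> l /= /rP[-> ->].
transitivity (\sum_(l <- r) \sum_(f : {ffun 'I_n -> 'I_k.+1} | sp f == l)
    level_term q x k [set: 'I_n] (fun i => f i)).
  rewrite big_seq_cond [RHS]big_seq; apply: eq_big => [l|l /andP[/rP[pl hl sl] _]].
    by apply: andb_idr => /rP[pl hl _]; apply/mem_set; rewrite /= pl hl.
  rewrite (hall_littlewood_levels pl hl sl); apply: eq_bigl => f.
  by rewrite rearrangesE // eq_sym.
rewrite (exchange_big_dep predT) //=.
rewrite [RHS](eq_bigl predT); last by move=> f; rewrite subsetT.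
apply: eq_bigr => f _; rewrite (eq_bigl (pred1 (sp f))); last by move=> l; rewrite /= eq_sym.
by rewrite -big_filter filter_pred1_uniq ?undup_uniq // big_seq1.
Qed.

End Rearrangements.

(** * Specialization to the field of rational functions *)

Lemma rf_q_neq0 n : rf_q n != 0.
Proof. by rewrite tofrac_eq0 mpolyC_eq0 polyX_eq0. Qed.

(** Evaluations of polynomials separate the two sides: at a unit vector for injectivity, at all ones
    for x_i and 0, and at the origin for a monomial divisible by some x_b and 1. *)
Lemma rf_x_generic n : generic (rf_q n) (@rf_x n).
Proof.
split=> [i j /eqP|i|B N /set0Pn[b bB]].
- rewrite tofrac_eq => /eqP /(congr1 (meval (fun k => (k == i)%:R : {poly rat}))).
  rewrite !mevalXU eqxx; have [->|_] // := eqVneq j i.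
  by move=> /eqP; rewrite oner_eq0.
- rewrite tofrac_eq0; apply/eqP => /(congr1 (meval (fun=> 1 : {poly rat}))).
  by rewrite mevalXU meval0 => /eqP; rewrite oner_eq0.
rewrite /rf_q /rf_x -rmorph_prod -rmorphXn -rmorphM -tofrac1 tofrac_eq.
apply/eqP => /(congr1 (meval (fun=> 0 : {poly rat}))).
rewrite rmorphM rmorph_prod rmorph1 (bigD1 b) //= mevalXU mul0r mulr0.
by move/esym/eqP; rewrite oner_eq0.
Qed.

Theorem theorem6p1 (n : nat) (n_gt0 : (0 < n)%N) :
  let q := rf_q n in
  let x := @rf_x n in
  Fps (fun k : nat =>
    \sum_(l \in [set l : seq nat | is_partition l && (head 0%N l <= k)%N]%classic)
       q ^+ partition_n l * hall_littlewood q x l)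
  = \sum_(I : {set 'I_n})
      (1 - 'u * (q ^+ 'C(#|I|, 2) * \prod_(i in I) x i)%:S)^-1 *
      ((\prod_(i in I) (1 - (x i)^-1 * q ^ (1 - #|I|%:Z))^-1) *
       (\prod_(j in ~: I) (1 - x j * q ^+ #|I|)^-1) *
       (\prod_(i in I) \prod_(j in ~: I)
          ((x i - q * x j) / (x i - x j))))%:S.
Proof.
move=> q x; apply: fpsP => k; rewrite fcoef_sum.
rewrite -[LHS]/(\sum_(l \in _) _) sum_hall_littlewood.
rewrite (hl_closedE (rf_q_neq0 n) _ _ (rf_x_generic n)).
apply: eq_big => [I|I _]; first by rewrite subsetT.
rewrite fcoef_mulC fps_geom setTD /hl_residue /hl_pole; congr (_ * (_ * _ * _)).
(* Since i lies in I, #|I| is positive and the integer power q^(1 - #|I|) is the inverse of q^(#|I|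
   - 1). *)
apply: eq_bigr => i iI; congr (1 - _)^-1; rewrite invfM; congr (_ * _).
have /prednK <- : (0 < #|I|)%N by apply/card_gt0P; exists i.
by rewrite -[in RHS]add1n PoszD opprD addrA subrr add0r -exprnN.
Qed.
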